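(* Let $U$ be a $d\times d$ unitary matrix, $U_{ij}=\langle a_i|b_j\rangle$ for two orthonormal bases $\{|a_i\rangle\}$, $\{|b_j\rangle\}$ of $\mathbb{C}^d$, and let $p_i=\langle a_i|\rho|a_i\rangle$, $q_j=\langle b_j|\rho|b_j\rangle$ for a state $\rho$ on $\mathbb{C}^d$. For $k=1,\dots,d$ let $s_k=\max\{\|M\|: M \text{ a submatrix of } U \text{ with } \#\mathrm{cols}(M)+\#\mathrm{rows}(M)=k+1\}$, where $\|M\|$ is the largest singular value, and let $W=(s_1,s_2-s_1,\dots,s_d-s_{d-1})$. Then for every Rényi order $0<\alpha\le 1$ (with $\alpha=1$ meaning the Shannon entropy), $$H_\alpha(p)+H_\alpha(q)\ge H_\alpha(W).$$
   Context: The Rényi entropy of order $\alpha\neq1$ of a probability vector $x$ is $H_\alpha(x)=\frac{1}{1-\alpha}\ln\sum_i x_i^\alpha$; its limit $\alpha\to1$ is the Shannon entropy $H(x)=-\sum_i x_i\ln x_i$ (with $0\ln 0=0$). A submatrix is obtained by selecting a nonempty set of rows and a nonempty set of columns. *)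

(* Defs.v *)
From HB Require Import structures.
From mathcomp Require Import all_boot all_order all_algebra.
From mathcomp Require Import all_classical all_reals all_analysis.
From mathcomp Require Import complex.

Set Implicit Arguments.
Unset Strict Implicit.
Unset Printing Implicit Defensive.

Import Order.TTheory GRing.Theory Num.Theory.
Local Open Scope classical_set_scope.
Local Open Scope ring_scope.
Local Open Scope complex_scope.

Section Defs.
Variable R : realType.

Definition adjmx (m n : nat) (M : 'M[R[i]]_(m, n)) : 'M[R[i]]_(n, m) :=
  (map_mx conjc M)^T.

Definition vnorm (n : nat) (v : 'cV[R[i]]_n) : R :=
  Num.sqrt (\sum_i ((complex.Re (v i 0)) ^+ 2 + (complex.Im (v i 0)) ^+ 2)).

(* ||M|| = largest singular value = operator norm induced by the Euclidean norm *)
Definition opnorm (m n : nat) (M : 'M[R[i]]_(m, n)) : R :=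
  sup [set vnorm (M *m v) | v in [set v : 'cV[R[i]]_n | vnorm v <= 1]].

Definition subU (d : nat) (U : 'M[R[i]]_d) (I J : {set 'I_d}) :
    'M[R[i]]_(#|I|, #|J|) :=
  \matrix_(i < #|I|, j < #|J|) U (@enum_val _ (mem I) i) (@enum_val _ (mem J) j).

Definition s_coef (d : nat) (U : 'M[R[i]]_d) (k : nat) : R :=
  sup [set opnorm (subU U IJ.1 IJ.2) | IJ in
        [set IJ : {set 'I_d} * {set 'I_d} |
           [/\ (0 < #|IJ.1|)%N, (0 < #|IJ.2|)%N & (#|IJ.1| + #|IJ.2| = k.+1)%N]]].

Definition Wvec (d : nat) (U : 'M[R[i]]_d) (i : 'I_d) : R :=
  s_coef U (i.+1) - (if i == 0%N :> nat then 0 else s_coef U i).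

Definition shannon (n : nat) (x : 'I_n -> R) : R :=
  - \sum_i (if x i == 0 then 0 else x i * ln (x i)).

Definition renyi (n : nat) (alpha : R) (x : 'I_n -> R) : R :=
  if alpha == 1 then shannon x
  else (1 - alpha)^-1 * ln (\sum_i (x i) `^ alpha).

Definition orthonormal_cols (d : nat) (A : 'M[R[i]]_d) : Prop :=
  forall i j : 'I_d, (adjmx (col i A) *m col j A) 0 0 = (i == j)%:R.

Definition density (d : nat) (rho : 'M[R[i]]_d) : Prop :=
  [/\ adjmx rho = rho,
      (forall v : 'cV[R[i]]_d, 0 <= (adjmx v *m rho *m v) 0 0)
    & \tr rho = 1].

Definition expect (d : nat) (rho : 'M[R[i]]_d) (a : 'cV[R[i]]_d) : R :=
  complex.Re ((adjmx a *m rho *m a) 0 0).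

End Defs.

(* Main.v *)
Require Import Defs.
From HB Require Import structures.
From mathcomp Require Import all_boot all_order all_algebra.
From mathcomp Require Import all_classical all_reals all_analysis.
From mathcomp Require Import complex ring lra.
Set Implicit Arguments.
Unset Strict Implicit.
Unset Printing Implicit Defensive.
Import Order.TTheory GRing.Theory Num.Theory.
Local Open Scope ring_scope.

(** The concatenation [(p, q)] is majorized by [(1, W)].  For nonempty sets [I]
    of rows and [J] of columns and a unit vector [phi], the weights of [phi] on
    the [a_i] with [i] in [I] and on the [b_j] with [j] in [J] add up to at most
    [1 + s], where [s] is the norm of the submatrix of [U] on [I] and [J]; the
    spectral decomposition of [rho] extends this to mixed states.  Hence the
    [k + 1] largest entries of [(p, q)] sum to at most [1 + s_k], the partial sum
    of [(1, W)].  A Karamata argument then gives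
    [f 1 + sum f(W) <= sum f(p) + sum f(q)] for concave [f].  With
    [f x = - x ln x] this is the Shannon case.  With [f x = x ^ alpha],
    [P = sum p^alpha >= 1] and [Q = sum q^alpha >= 1], it yields
    [P Q >= P + Q - 1 >= sum W^alpha]. *)

(** * Real inner product on complex vectors and the weight bound for a pure state *)

Section RealDotProduct.
Local Open Scope complex_scope.
Context {R : realType}.
Local Notation C := (R[i]).

Definition cnorm2 (z : C) : R := complex.Re z ^+ 2 + complex.Im z ^+ 2.

Lemma cnorm2_ge0 z : 0 <= cnorm2 z.
Proof. by rewrite addr_ge0 ?sqr_ge0. Qed.

Lemma cnorm20 : cnorm2 0 = 0.
Proof. by rewrite /cnorm2 /= expr0n addr0. Qed.

Lemma cnorm2_conj z : cnorm2 (conjc z) = cnorm2 z.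
Proof. by case: z => a b; rewrite /cnorm2 /= sqrrN. Qed.

(** Inner product of C^n viewed as R^(2n): expanding squared norms only produces real parts. *)
Definition rdot n (x y : 'cV[C]_n) : R :=
  \sum_i (complex.Re (x i 0) * complex.Re (y i 0)
          + complex.Im (x i 0) * complex.Im (y i 0)).

Definition vnorm2 n (v : 'cV[C]_n) : R := \sum_i cnorm2 (v i 0).

Lemma vnormE n (v : 'cV[C]_n) : vnorm v = Num.sqrt (vnorm2 v).
Proof. by []. Qed.

Lemma vnorm2_ge0 n (v : 'cV[C]_n) : 0 <= vnorm2 v.
Proof. by apply: sumr_ge0 => i _; apply: cnorm2_ge0. Qed.

Lemma rdotvv n (v : 'cV[C]_n) : rdot v v = vnorm2 v.
Proof. by apply: eq_bigr => i _; rewrite /cnorm2 !expr2. Qed.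

Lemma vnorm2D n (x y : 'cV[C]_n) :
  vnorm2 (x + y) = vnorm2 x + 2 * rdot x y + vnorm2 y.
Proof.
rewrite /vnorm2 /rdot mulr_sumr -!big_split; apply: eq_bigr => i _ /=.
rewrite mxE /cnorm2; case: (x i 0) => a b; case: (y i 0) => a' b' /=.
ring.
Qed.

Lemma rdot_vnorm2_eq0 n (x y : 'cV[C]_n) : vnorm2 y = 0 -> rdot x y = 0.
Proof.
move=> y0; apply: big1 => i _.
have /eqP := psumr_eq0P (fun i _ => cnorm2_ge0 (y i 0)) y0 (erefl : xpredT i).
rewrite /cnorm2 paddr_eq0 ?sqr_ge0// !sqrf_eq0 => /andP[/eqP-> /eqP->].
by rewrite !mulr0 addr0.
Qed.

Lemma vnorm2_rscaleB n (t : R) (x y : 'cV[C]_n) :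
  vnorm2 (t%:C *: x - y) = t ^+ 2 * vnorm2 x - 2 * t * rdot x y + vnorm2 y.
Proof.
rewrite /vnorm2 /rdot !mulr_sumr -sumrB -big_split; apply: eq_bigr => i _ /=.
rewrite !mxE /cnorm2; case: (x i 0) => a b; case: (y i 0) => a' b' /=.
ring.
Qed.

Lemma vnorm2_rscale n (t : R) (x : 'cV[C]_n) :
  vnorm2 (t%:C *: x) = t ^+ 2 * vnorm2 x.
Proof.
rewrite /vnorm2 mulr_sumr; apply: eq_bigr => i _ /=.
rewrite !mxE /cnorm2; case: (x i 0) => a b /=; ring.
Qed.

Lemma rdotDr n (x y z : 'cV[C]_n) : rdot x (y + z) = rdot x y + rdot x z.
Proof.
rewrite /rdot -big_split; apply: eq_bigr => i _ /=.
rewrite !mxE; case: (y i 0) => a b; case: (z i 0) => a' b' /=; ring.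
Qed.

Lemma rdotE n (x y : 'cV[C]_n) : rdot x y = complex.Re ((adjmx x *m y) 0 0).
Proof.
rewrite mxE raddf_sum; apply: eq_bigr => i _ /=; rewrite !mxE.
by case: (x i 0) => a b; case: (y i 0) => a' b' /=; ring.
Qed.

Lemma adjmxM m n p (M : 'M[C]_(m, n)) (N : 'M[C]_(n, p)) :
  adjmx (M *m N) = adjmx N *m adjmx M.
Proof. by rewrite /adjmx map_mxM trmx_mul. Qed.

Lemma adjmxK m n (M : 'M[C]_(m, n)) : adjmx (adjmx M) = M.
Proof. by apply/matrixP => i j; rewrite !mxE conjcK. Qed.

Lemma rdot_adjoint m n (M : 'M[C]_(m, n)) x y :
  rdot x (M *m y) = rdot (adjmx M *m x) y.
Proof. by rewrite !rdotE adjmxM adjmxK mulmxA. Qed.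

Lemma vnorm2_isometry m n (M : 'M[C]_(m, n)) v :
  adjmx M *m M = 1%:M -> vnorm2 (M *m v) = vnorm2 v.
Proof. by move=> h; rewrite -!rdotvv rdot_adjoint mulmxA h mul1mx. Qed.

Definition vrestrict n (J : {set 'I_n}) (v : 'cV[C]_n) : 'cV[C]_n :=
  \col_i (if i \in J then v i 0 else 0).

Lemma vnorm2_restrict n (J : {set 'I_n}) v :
  vnorm2 (vrestrict J v) = \sum_(i in J) cnorm2 (v i 0).
Proof.
rewrite [RHS]big_mkcond; apply: eq_bigr => i _; rewrite mxE.
by case: ifP => // _; rewrite cnorm20.
Qed.

Lemma rdot_restrict n (J : {set 'I_n}) x y :
  rdot x (vrestrict J y) = rdot (vrestrict J x) (vrestrict J y).
Proof. by apply: eq_bigr => i _; rewrite !mxE; case: (i \in J) => /=; ring. Qed.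

Lemma rdot_restrictl n (J : {set 'I_n}) x y :
  rdot (vrestrict J x) y = rdot (vrestrict J x) (vrestrict J y).
Proof. by apply: eq_bigr => i _; rewrite !mxE; case: (i \in J) => //=; ring. Qed.

(* [submx_bound U I J s]: the compression of [U] to the rows in [I] and the
   columns in [J] has operator norm at most [s]. *)
Definition submx_bound n (U : 'M[C]_n) (I J : {set 'I_n}) (s : R) : Prop :=
  forall v : 'cV[C]_n,
    vnorm2 (vrestrict I (U *m vrestrict J v)) <= s ^+ 2 * vnorm2 (vrestrict J v).

(* Expand [0 <= |(1 + s) phi - x - U y|^2], where [x] and [y] are the
   restrictions of [phi] and of [U^* phi]. *)
Lemma two_basis_weight_le n (U : 'M[C]_n) (I J : {set 'I_n}) (s : R) phi :
  adjmx U *m U = 1%:M -> 0 <= s -> submx_bound U I J s ->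
  vnorm2 (vrestrict I phi) + vnorm2 (vrestrict J (adjmx U *m phi))
  <= (1 + s) * vnorm2 phi.
Proof.
move=> hU s0 hs.
set x := vrestrict I phi; set y := vrestrict J (adjmx U *m phi).
have hz := hs (adjmx U *m phi); rewrite -/y in hz.
have cross : 2 * rdot x (U *m y) <= s * (vnorm2 x + vnorm2 y).
  have -> : rdot x (U *m y) = rdot x (vrestrict I (U *m y)).
    exact: rdot_restrictl.
  (* The square expanded below yields [s] times the claim, so [s = 0] is treated apart; there [U y]
     vanishes on [I]. *)
  move: s0; rewrite le_eqVlt => /predU1P[s0|s0].
    have h0 : vnorm2 (vrestrict I (U *m y)) = 0.
      apply/eqP; rewrite eq_le vnorm2_ge0 andbT (le_trans hz)//.
      by rewrite -s0 expr0n mul0r.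
    by rewrite rdot_vnorm2_eq0// -s0 mulr0 mul0r.
  have := vnorm2_ge0 (s%:C *: x - vrestrict I (U *m y)).
  rewrite vnorm2_rscaleB => h.
  rewrite -(ler_pM2l s0); nra.
(* Here [rdot phi x = |x|^2], [rdot phi (U y) = |y|^2] and [|U y| = |y|]; together with [cross], the
   expansion gives [1 + s] times the claim. *)
have := vnorm2_ge0 ((1 + s)%:C *: phi - (x + U *m y)).
rewrite vnorm2_rscaleB rdotDr vnorm2D rdot_adjoint vnorm2_isometry//.
rewrite rdot_restrict rdotvv rdot_restrict rdotvv -/x -/y => h.
have s1 : 0 < 1 + s by lra.
rewrite -(ler_pM2l s1); nra.
Qed.
End RealDotProduct.

(** * Norms of submatrices and the coefficients [s_k] *)

Section SubmatrixNorm.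
Local Open Scope complex_scope.
Context {R : realType}.
Local Notation C := (R[i]).
Variables (n : nat) (U : 'M[C]_n).

Lemma vnorm2_restrict_subset (I I' : {set 'I_n}) (v : 'cV[C]_n) :
  I \subset I' -> vnorm2 (vrestrict I v) <= vnorm2 (vrestrict I' v).
Proof.
move=> sII'; apply: ler_sum => i _; rewrite !mxE.
case: ifP => [/(fintype.subsetP sII')->//|_]; rewrite cnorm20; exact: cnorm2_ge0.
Qed.

Lemma restrict_setT (v : 'cV[C]_n) : vrestrict [set: 'I_n] v = v.
Proof. by apply/colP => i; rewrite mxE inE. Qed.

Lemma submx_bound_subset (I I' J J' : {set 'I_n}) (s : R) :
  I \subset I' -> J \subset J' -> submx_bound U I' J' s -> submx_bound U I J s.
Proof.
move=> sI sJ h v; apply: le_trans (vnorm2_restrict_subset _ sI) _.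
have -> : vrestrict J v = vrestrict J' (vrestrict J v); last exact: h.
apply/colP => i; rewrite !mxE; case: ifP => [/(fintype.subsetP sJ)->//|_].
by case: ifP.
Qed.

Hypothesis unitaryU : adjmx U *m U = 1%:M.

Lemma submx_bound1 (I J : {set 'I_n}) : submx_bound U I J 1.
Proof.
move=> v; rewrite expr1n mul1r.
apply: le_trans (vnorm2_restrict_subset _ (finset.subsetT I)) _.
by rewrite restrict_setT vnorm2_isometry.
Qed.

(** Carries full-length vectors to the index type ['I_#|J|] on which [subU] acts. *)
Let sel (J : {set 'I_n}) (v : 'cV[C]_n) : 'cV[C]_#|J| :=
  \col_j v (@enum_val _ (mem J) j) 0.

Let vnorm2_sel (J : {set 'I_n}) v : vnorm2 (sel J v) = vnorm2 (vrestrict J v).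
Proof.
rewrite vnorm2_restrict big_enum_val; apply: eq_bigr => j _.
by rewrite mxE.
Qed.

Let sel_surj (J : {set 'I_n}) (w : 'cV[C]_#|J|) : exists v, w = sel J v.
Proof.
exists (\col_i \sum_(j | @enum_val _ (mem J) j == i) w j 0).
apply/colP => j; rewrite !mxE (big_pred1 j)// => j' /=.
by rewrite (inj_eq enum_val_inj).
Qed.

Let subU_sel (I J : {set 'I_n}) v : subU U I J *m sel J v = sel I (U *m vrestrict J v).
Proof.
apply/colP => i; rewrite !mxE.
under eq_bigr do rewrite !mxE.
rewrite -(big_enum_val (A := mem J) (fun j => U (enum_val i) j * v j 0)) /=.
rewrite big_mkcond; apply: eq_bigr => j _; rewrite mxE.
by case: ifP => _; rewrite ?mulr0.
Qed.

Let opset (I J : {set 'I_n}) : set R :=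
  [set vnorm (subU U I J *m v) | v in [set v : 'cV[C]_#|J| | vnorm v <= 1]]%classic.

Let opset_le (I J : {set 'I_n}) s : 0 <= s -> submx_bound U I J s -> ubound (opset I J) s.
Proof.
move=> s0 hs _ [w /= + <-]; have [v ->] := sel_surj w.
rewrite subU_sel !vnormE !vnorm2_sel => hv.
apply: (@le_trans _ _ (Num.sqrt (s ^+ 2 * vnorm2 (vrestrict J v)))).
  by rewrite ler_sqrt ?mulr_ge0 ?sqr_ge0 ?vnorm2_ge0.
rewrite sqrtrM ?sqr_ge0// sqrtr_sqr ger0_norm//.
by rewrite -[leRHS]mulr1 ler_wpM2l.
Qed.

Let opset0 (I J : {set 'I_n}) : opset I J 0.
Proof.
exists 0; rewrite /= ?mulmx0 vnormE /vnorm2 big1 ?sqrtr0 ?ler01// => i _;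
by rewrite mxE cnorm20.
Qed.

Let opset_ub (I J : {set 'I_n}) : has_ubound (opset I J).
Proof. by exists 1; apply: opset_le => //; apply: submx_bound1. Qed.

Lemma opnorm_subU_ge0 (I J : {set 'I_n}) : 0 <= opnorm (subU U I J).
Proof. exact: (ub_le_sup (opset_ub I J) (opset0 I J)). Qed.

Lemma opnorm_subU_le (I J : {set 'I_n}) (s : R) :
  0 <= s -> submx_bound U I J s -> opnorm (subU U I J) <= s.
Proof.
move=> s0 hs; apply: (@ge_sup _ (opset I J)); last exact: opset_le.
by exists 0; apply: opset0.
Qed.

(** The supremum only covers vectors of norm at most 1, so a nonzero restriction of [v] is
    normalised by [t]; a zero one is settled by the contraction bound. *)
Lemma opnorm_subU_bound (I J : {set 'I_n}) :
  submx_bound U I J (opnorm (subU U I J)).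
Proof.
move=> v; have := vnorm2_ge0 (vrestrict J v).
rewrite le_eqVlt => /predU1P[h0|h0].
  rewrite -h0 mulr0; apply: le_trans (submx_bound1 I J v) _.
  by rewrite -h0 mulr0.
set t := (Num.sqrt (vnorm2 (vrestrict J v)))^-1.
have t0 : 0 < t by rewrite invr_gt0 sqrtr_gt0.
have tE : t ^+ 2 * vnorm2 (vrestrict J v) = 1.
  by rewrite exprVn sqr_sqrtr ?ltW// mulVf// gt_eqF.
have restrictZ K (u : 'cV[C]_n) : vrestrict K (t%:C *: u) = t%:C *: vrestrict K u.
  by apply/colP => i; rewrite !mxE; case: ifP; rewrite ?mulr0.
have : opset I J (vnorm (subU U I J *m sel J (t%:C *: v))).
  exists (sel J (t%:C *: v)) => //=; rewrite vnormE vnorm2_sel restrictZ.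
  by rewrite vnorm2_rscale tE sqrtr1.
move/(ub_le_sup (opset_ub I J)); rewrite -/(opnorm (subU U I J)).
rewrite subU_sel vnormE vnorm2_sel restrictZ -scalemxAr restrictZ vnorm2_rscale => h.
have : t ^+ 2 * vnorm2 (vrestrict I (U *m vrestrict J v)) <= opnorm (subU U I J) ^+ 2.
  rewrite -[leLHS]sqr_sqrtr; last by apply: mulr_ge0; rewrite ?sqr_ge0 ?vnorm2_ge0.
  by rewrite ler_pXn2r ?nnegrE ?sqrtr_ge0 ?opnorm_subU_ge0.
by move/(ler_wpM2r (ltW h0)); rewrite mulrAC tE mul1r.
Qed.

Lemma opnorm_subU_le1 (I J : {set 'I_n}) : opnorm (subU U I J) <= 1.
Proof. exact: opnorm_subU_le (@ler01 _) (submx_bound1 I J). Qed.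

Lemma opnorm_subU_subset (I I' J J' : {set 'I_n}) :
  I \subset I' -> J \subset J' ->
  opnorm (subU U I J) <= opnorm (subU U I' J').
Proof.
move=> sI sJ; apply: opnorm_subU_le (opnorm_subU_ge0 _ _) _.
exact: submx_bound_subset sI sJ (opnorm_subU_bound I' J').
Qed.

Let sset k : set R := [set opnorm (subU U IJ.1 IJ.2) | IJ in
  [set IJ : {set 'I_n} * {set 'I_n} |
     [/\ (0 < #|IJ.1|)%N, (0 < #|IJ.2|)%N & (#|IJ.1| + #|IJ.2| = k.+1)%N]]]%classic.

Let sset_ub k : has_ubound (sset k).
Proof. by exists 1 => _ [IJ _ <-]; apply: opnorm_subU_le1. Qed.

Lemma opnorm_le_s_coef (I J : {set 'I_n}) k :
  (0 < #|I|)%N -> (0 < #|J|)%N -> (#|I| + #|J| = k.+1)%N ->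
  opnorm (subU U I J) <= s_coef U k.
Proof. by move=> I0 J0 IJ; apply: (ub_le_sup (sset_ub k)); exists (I, J). Qed.

Let sset_neq0 k : (0 < k <= n)%N -> (sset k !=set0)%classic.
Proof.
move=> /andP[k0 kn].
have n0 : (0 < n)%N by apply: leq_trans kn.
(* A shape available for each [k]: the first [k] rows and one column. *)
exists (opnorm (subU U [set i : 'I_n | (i < k)%N] [set Ordinal n0])).
exists ([set i : 'I_n | (i < k)%N], [set Ordinal n0]) => //=.
rewrite cards1.
have -> : #|[set i : 'I_n | (i < k)%N]| = k; last by rewrite addn1.
rewrite -sum1dep_card.
rewrite -(big_ord_widen n (fun=> 1%N) kn).
by rewrite sum1_card card_ord.
Qed.

Lemma s_coef_ge0 k : (0 < k <= n)%N -> 0 <= s_coef U k.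
Proof.
move=> hk; have [_ [[I J] /= [I0 J0 IJ] _]] := sset_neq0 hk.
exact: le_trans (opnorm_subU_ge0 I J) (opnorm_le_s_coef I0 J0 IJ).
Qed.

Lemma s_coef_le k x : (0 < k <= n)%N ->
  (forall I J : {set 'I_n}, (0 < #|I|)%N -> (0 < #|J|)%N ->
    (#|I| + #|J| = k.+1)%N -> opnorm (subU U I J) <= x) ->
  s_coef U k <= x.
Proof.
move=> hk h; apply: (@ge_sup _ (sset k)); first exact: sset_neq0.
by move=> _ [[I J] /= [I0 J0 IJ] <-]; apply: h.
Qed.

Lemma s_coef_nondecreasing k : (0 < k < n)%N -> s_coef U k <= s_coef U k.+1.
Proof.
move=> /andP[k0 kn]; apply: s_coef_le; first by rewrite k0 ltnW.
move=> I J I0 J0 IJ.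
(* A further row can be added: if [I] held all rows, [#|J| >= 1] would force [k >= n]. *)
have [i iI] : exists i, i \notin I.
  apply/existsP; rewrite -negb_forall; apply/negP => /forallP h.
  have : #|I| = n by rewrite -[RHS]card_ord; apply/eq_card => i; rewrite h.
  move=> In; move: IJ kn; rewrite In -(prednK J0) addnS => -[<-].
  by rewrite ltnNge leq_addr.
apply: le_trans (opnorm_subU_subset (finset.subsetUr [set i] I) (subxx J)) _.
apply: opnorm_le_s_coef => //; rewrite cardsU1 iI ?addnS//.
by rewrite !add1n addSn IJ.
Qed.

Lemma s_coef_last : (0 < n)%N -> s_coef U n = 1.
Proof.
move=> n0; apply/eqP; rewrite eq_le; apply/andP; split.
  by apply: s_coef_le => *; rewrite ?n0 ?leqnn// opnorm_subU_le1.
apply: (@le_trans _ _ (opnorm (subU U [set: 'I_n] [set Ordinal n0]))); last first.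
  by apply: opnorm_le_s_coef; rewrite ?cards1 ?cardsT ?card_ord ?addn1.
set s := opnorm _; have s0 : 0 <= s by exact: opnorm_subU_ge0.
(* A full column of [U] is a unit vector: the all-ones vector restricted to one index is a basis
   vector, and [U] is an isometry. *)
have := @opnorm_subU_bound [set: 'I_n] [set Ordinal n0] (const_mx 1).
rewrite restrict_setT vnorm2_isometry// -/s.
rewrite vnorm2_restrict big_set1 mxE /cnorm2 /= expr0n addr0 expr1n mulr1.
by rewrite -{1}(expr1n _ 2) ler_pXn2r ?nnegrE.
Qed.

Lemma Wvec_ge0 (i : 'I_n) : 0 <= Wvec U i.
Proof.
rewrite /Wvec; case: eqP => [_|/eqP i0].
  by rewrite subr0 s_coef_ge0//= ltn_ord.
by rewrite subr_ge0 s_coef_nondecreasing// lt0n i0 ltn_ord.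
Qed.

End SubmatrixNorm.

(** * Mixed states through their spectral decomposition *)

Section DensityMatrix.
Local Open Scope complex_scope.
Context {R : realType}.
Local Notation C := (R[i]).

Lemma orthonormal_colsE n (A : 'M[C]_n) :
  orthonormal_cols A -> adjmx A *m A = 1%:M.
Proof.
move=> h; apply/matrixP => i j; rewrite [RHS]mxE -h !mxE.
by apply: eq_bigr => k _; rewrite !mxE.
Qed.

(** Spectral theorem: the [r k] are the eigenvalues of [rho], and row [k] of [P] is the adjoint of a
    unit eigenvector, so [cnorm2 ((P *m a) k 0)] is its squared overlap with [a]. *)
Lemma density_pure_decomposition n (rho : 'M[C]_n) : density rho ->
  exists (P : 'M[C]_n) (r : 'I_n -> R),
    [/\ P *m adjmx P = 1%:M, forall k, 0 <= r k, \sum_k r k = 1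
      & forall a : 'cV[C]_n, expect rho a = \sum_k r k * cnorm2 ((P *m a) k 0)].
Proof.
move=> [herm pos tr1].
have trmxC m p (M : 'M[C]_(m, p)) : (M^T ^ Num.conj)%sesqui = adjmx M.
  by apply/matrixP => i j; rewrite !mxE.
have normal_rho : rho \is normalmx by apply/normalmxP; rewrite trmxC herm.
have /orthomx_spectralP := normal_rho.
have /unitarymxP := spectral_unitarymx rho.
have := invmx_unitary (spectral_unitarymx rho).
move: (spectralmx rho) (spectral_diag rho) => P D; rewrite trmxC => -> PP rhoE.
have quadE (a : 'cV[C]_n) : (adjmx a *m rho *m a) 0 0 =
    \sum_k D 0 k * (cnorm2 ((P *m a) k 0))%:C.
  have -> : adjmx a *m rho *m a = adjmx (P *m a) *m (diag_mx D *m (P *m a)).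
    by rewrite rhoE adjmxM !mulmxA.
  rewrite mxE; apply: eq_bigr => k _; rewrite mul_diag_mx !mxE.
  move: (\sum_j _) => [x y]; case: (D 0 k) => z t.
  by rewrite /cnorm2; simpc; congr (_ +i* _)%C; rewrite /=; ring.
have D_ge0 k : 0 <= D 0 k.
  (* Positivity tested on the [k]-th eigenvector isolates the eigenvalue [D 0 k]. *)
  have := pos (adjmx P *m delta_mx k 0); rewrite quadE mulmxA PP mul1mx.
  rewrite (bigD1 k)//= big1 ?addr0 => [|j /negPf jk].
    by rewrite mxE !eqxx /cnorm2 /= expr0n addr0 expr1n mulr1.
  by rewrite mxE jk cnorm20 mulr0.
exists P, (fun k => complex.Re (D 0 k)); split => //.
- by move=> k; have := D_ge0 k; rewrite lecE => /andP[].
- rewrite -raddf_sum.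
  have -> : \sum_k D 0 k = \tr rho; last by rewrite tr1.
  rewrite rhoE -mulmxA mxtrace_mulC -mulmxA PP mulmx1.
  by apply: eq_bigr => k _; rewrite mxE eqxx.
- move=> a; rewrite /expect quadE raddf_sum; apply: eq_bigr => k _ /=.
  by case: (D 0 k) => x y /=; ring.
Qed.

Variables (n : nat) (A B rho : 'M[C]_n).
Hypotheses (oA : orthonormal_cols A) (oB : orthonormal_cols B).
Hypothesis drho : density rho.
Let U := adjmx A *m B.

Lemma overlap_isometry : adjmx U *m U = 1%:M.
Proof.
rewrite adjmxM adjmxK mulmxA -(mulmxA _ A) (mulmx1C (orthonormal_colsE oA)).
by rewrite mulmx1 orthonormal_colsE.
Qed.

Lemma expect_ge0 (a : 'cV[C]_n) : 0 <= expect rho a.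
Proof.
by case: drho => _ /(_ a) + _; rewrite lecE => /andP[].
Qed.

(** For [P] from the spectral decomposition: coordinates of the [k]-th eigenvector in the basis of
    columns of [M]. *)
Let amplitude (P M : 'M[C]_n) k : 'cV[C]_n := adjmx (P *m M) *m delta_mx k 0.

Let cnorm2_amplitude (P M : 'M[C]_n) k i :
  cnorm2 (amplitude P M k i 0) = cnorm2 ((P *m col i M) k 0).
Proof.
rewrite /amplitude -colE mxE -cnorm2_conj !mxE conjcK; congr cnorm2.
by apply: eq_bigr => j _; rewrite mxE.
Qed.

Let vnorm2_amplitude (P M : 'M[C]_n) k :
  P *m adjmx P = 1%:M -> orthonormal_cols M -> vnorm2 (amplitude P M k) = 1.
Proof.
move=> PP oM; rewrite vnorm2_isometry ?adjmxK.
  rewrite /vnorm2 (bigD1 k)//= big1 ?addr0 => [|j /negPf jk].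
    by rewrite mxE !eqxx /cnorm2 /= expr0n addr0 expr1n.
  by rewrite mxE jk cnorm20.
by rewrite adjmxM mulmxA -(mulmxA P) (mulmx1C (orthonormal_colsE oM)) mulmx1.
Qed.

(** Parseval for each eigenvector; the eigenvalues sum to 1. *)
Lemma sum_expect (M : 'M[C]_n) : orthonormal_cols M ->
  \sum_i expect rho (col i M) = 1.
Proof.
move=> oM; have [P [r [PP _ r1 rE]]] := density_pure_decomposition drho.
under eq_bigr do rewrite rE.
rewrite exchange_big -[RHS]r1; apply: eq_bigr => k _ /=.
rewrite -mulr_sumr -[RHS]mulr1 -(vnorm2_amplitude k PP oM); congr (_ * _).
by apply: eq_bigr => i _; rewrite cnorm2_amplitude.
Qed.

(** The pure-state bound holds for each eigenvector and survives averaging with the weights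
    [r k]. *)
Lemma expect_weight_le (I J : {set 'I_n}) :
  \sum_(i in I) expect rho (col i A) + \sum_(j in J) expect rho (col j B)
  <= 1 + opnorm (subU U I J).
Proof.
have isoU := overlap_isometry.
set s := opnorm _; have s0 : 0 <= s by exact: opnorm_subU_ge0.
have hs : submx_bound U I J s by exact: opnorm_subU_bound.
have [P [r [PP r0 r1 rE]]] := density_pure_decomposition drho.
under eq_bigr do rewrite rE.
under [X in _ + X]eq_bigr do rewrite rE.
rewrite exchange_big [X in _ + X]exchange_big -big_split /=.
rewrite -[leRHS]mulr1 -[X in _ <= _ * X]r1 mulr_sumr; apply: ler_sum => k _.
rewrite -!mulr_sumr -mulrDr mulrC ler_wpM2r//.
have := two_basis_weight_le (amplitude P A k) isoU s0 hs.
rewrite vnorm2_amplitude// mulr1; move=> h; apply: le_trans h.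
(* Since [A A^* = 1], [U^* = B^* A] turns coordinates in the basis [A] into coordinates in the basis
   [B]. *)
have -> : adjmx U *m amplitude P A k = amplitude P B k.
  rewrite /amplitude mulmxA -adjmxM /U mulmxA -(mulmxA P).
  by rewrite (mulmx1C (orthonormal_colsE oA)) mulmx1.
by rewrite !vnorm2_restrict; apply: lerD; apply: ler_sum => i _;
  rewrite cnorm2_amplitude.
Qed.

End DensityMatrix.

(** * Majorization and Karamata's inequality *)

Section Majorization.
Context {R : realType}.

(** Summation by parts: the increments of [c] are nonnegative, the partial sums of [x - y]
    nonpositive, and the total is zero. *)
Lemma abel_sum_ge0 n (c x y : nat -> R) :
  (forall i, (i.+1 < n)%N -> c i <= c i.+1) ->
  (forall m, (m <= n)%N -> \sum_(i < m) x i <= \sum_(i < m) y i) ->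
  \sum_(i < n) x i = \sum_(i < n) y i ->
  0 <= \sum_(i < n) c i * (x i - y i).
Proof.
move=> cmono xy; case: n cmono xy => [|n] cmono xy xyn; first by rewrite big_ord0.
(* The claim is strengthened to every truncation; at the last index the left side vanishes. *)
suff abel m : (m <= n)%N ->
    c m * (\sum_(i < m.+1) (x i - y i)) <= \sum_(i < m.+1) c i * (x i - y i).
  by have := abel n (leqnn n); rewrite sumrB xyn subrr mulr0.
elim: m => [_|m IH mn]; first by rewrite !big_ord1.
rewrite [in leRHS]big_ord_recr/= [in leLHS]big_ord_recr/= mulrDr lerD2r.
apply: le_trans (IH (ltnW mn)); rewrite ler_wnM2r ?cmono//.
by rewrite sumrB subr_le0 xy// ltnS ltnW.
Qed.

(** Concavity of [f] on the nonnegative reals, expressed by supergradients [c x] at positive [x]. *)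
Variables f c : R -> R.
Hypothesis f0 : f 0 = 0.
Hypothesis tangent : forall x y, 0 < x -> 0 <= y -> f y <= f x + c x * (y - x).
Hypothesis slope_nonincreasing : forall x x', 0 < x -> x <= x' -> c x' <= c x.

(* [f] may have infinite slope at [0]; since only finitely many points [y i]
   occur, a large finite slope [K] serves as a supergradient there. *)
Lemma karamata_sorted n (x y : nat -> R) :
  (forall i, (i < n)%N -> 0 <= x i) -> (forall i, (i < n)%N -> 0 <= y i) ->
  (forall i, (i.+1 < n)%N -> x i.+1 <= x i) ->
  (forall m, (m <= n)%N -> \sum_(i < m) x i <= \sum_(i < m) y i) ->
  \sum_(i < n) x i = \sum_(i < n) y i ->
  \sum_(i < n) f (y i) <= \sum_(i < n) f (x i).
Proof.
move=> x0 y0 xmono xy xyn.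
(* [K] dominates every supergradient in use and every chord slope [f (y i) / y i] from the
   origin. *)
pose K := \sum_(i < n) `|c (x i)| + \sum_(i < n) `|f (y i) / y i|.
have le_term (h : nat -> R) i : (i < n)%N -> `|h i| <= \sum_(j < n) `|h j|.
  move=> i_n; rewrite (bigD1 (Ordinal i_n))//= lerDl.
  by apply: sumr_ge0 => j _; apply: normr_ge0.
have sum_ge0 (h : nat -> R) : 0 <= \sum_(j < n) `|h j|.
  by apply: sumr_ge0 => j _; apply: normr_ge0.
have cK i : (i < n)%N -> c (x i) <= K.
  move=> i_n; apply: le_trans (ler_norm _) _.
  apply: le_trans (le_term (fun i => c (x i)) i i_n) _.
  by rewrite lerDl (sum_ge0 (fun i => f (y i) / y i)).
have fK i : (i < n)%N -> f (y i) <= K * y i.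
  move=> i_n; have [->|yi] := eqVneq (y i) 0; first by rewrite f0 mulr0.
  rewrite -[leLHS](divfK yi) ler_wpM2r ?y0//; apply: le_trans (ler_norm _) _.
  apply: le_trans (le_term (fun i => f (y i) / y i) i i_n) _.
  by rewrite lerDr (sum_ge0 (fun i => c (x i))).
pose slope i := if x i == 0 then K else c (x i).
suff : 0 <= \sum_(i < n) slope i * (x i - y i).
  move=> h; rewrite -subr_ge0 -sumrB; apply: le_trans h _.
  apply: ler_sum => i _; rewrite /slope; have [xi|xi] := eqVneq (x i) 0.
    by rewrite xi f0 !sub0r mulrN lerN2 fK.
  have /tangent/(_ (y0 i (ltn_ord i))) : 0 < x i by rewrite lt0r xi x0.
  by move=> h; lra.
(* Slopes increase with the index: [x] decreases, and its zeros, carrying the largest slope [K],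
   come last. *)
apply: abel_sum_ge0 => // i i_n; rewrite /slope.
have [xi|xi] := eqVneq (x i) 0.
  case: eqP => // xi1; exfalso; apply: xi1; apply/eqP.
  by rewrite eq_le x0// andbT -xi xmono.
have [xi1|xi1] := eqVneq (x i.+1) 0; first by rewrite cK// ltnW.
by rewrite slope_nonincreasing ?xmono// lt0r xi1 x0.
Qed.

(** Sorting [g] in decreasing order reduces to sequences; the first [m] sorted elements form a set
    [S] of size [m]. *)
Lemma karamata (T : finType) (g : T -> R) (y : nat -> R) :
  (forall e, 0 <= g e) -> (forall i, 0 <= y i) ->
  (forall S : {set T}, \sum_(e in S) g e <= \sum_(i < #|S|) y i) ->
  \sum_e g e = \sum_(i < #|T|) y i ->
  \sum_(i < #|T|) f (y i) <= \sum_e f (g e).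
Proof.
move=> g0 y0 gy gyT.
pose geg (a b : T) := g b <= g a.
pose s := sort geg (enum T).
have perm_s : perm_eq s (enum T) by rewrite perm_sort.
have uniq_s : uniq s by rewrite sort_uniq enum_uniq.
have size_s : size s = #|T| by rewrite size_sort cardE.
have sorted_s : sorted geg s by apply: sort_sorted => a b; apply: le_total.
pose x i := nth 0 (map g s) i.
have sum_x m : (m <= #|T|)%N -> \sum_(i < m) x i = \sum_(e <- take m s) g e.
  move=> mT; rewrite -(big_map g predT id) map_take (big_nth 0) big_mkord.
  rewrite size_takel ?size_map ?size_s//.
  by apply: eq_bigr => i _; rewrite nth_take.
have sum_h (h : R -> R) : \sum_(i < #|T|) h (x i) = \sum_e h (g e).
  rewrite -[RHS]big_enum -(perm_big _ perm_s) -(big_map g predT h).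
  by rewrite (big_nth 0) big_mkord size_map size_s.
rewrite -(sum_h f); apply: karamata_sorted => //.
- move=> i i_n; rewrite /x.
  have /mapP[e _ ->] : nth 0 (map g s) i \in map g s.
    by rewrite mem_nth// size_map size_s.
  exact: g0.
- move=> i i_n.
  have /sortedP/(_ _) : sorted >=%R (map g s) by rewrite sorted_map.
  by apply; rewrite size_map size_s.
- move=> m mT; rewrite sum_x// big_uniq ?take_uniq//=.
  have := gy [set e in take m s]; rewrite cardsE (card_uniqP _) ?take_uniq//.
  rewrite size_takel ?size_s// => h; apply: le_trans h.
  by rewrite le_eqVlt; apply/orP; left; apply/eqP; apply: eq_bigl => e; rewrite inE.
- by rewrite (sum_h id).
Qed.

End Majorization.

(** * Tangent inequalities for powers and for [- x ln x] *)

Section EntropyFunctions.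
Context {R : realType}.

(** Young's inequality for [t^a] and [1] with conjugate exponents [1/a] and [1/(1-a)]. *)
Lemma powR_le_tangent1 (a t : R) : 0 < a < 1 -> 0 <= t ->
  t `^ a <= 1 + a * (t - 1).
Proof.
move=> /andP[a0 a1] t0.
have := @conjugate_powR R (t `^ a) 1 a^-1 (1 - a)^-1.
rewrite !invrK powR_ge0 ler01 !invr_gt0 a0 subr_gt0 a1 addrC subrK mulr1.
move/(_ isT isT isT isT erefl); rewrite -powRrM mulfV ?gt_eqF// powRr1// powR1.
by move=> h; lra.
Qed.

(** By homogeneity: the tangent at 1, evaluated at [y / x], times [x^a]. *)
Lemma powR_le_tangent (a x y : R) : 0 < a < 1 -> 0 < x -> 0 <= y ->
  y `^ a <= x `^ a + a * x `^ (a - 1) * (y - x).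
Proof.
move=> ha x0 y0; have yx0 : 0 <= y / x by rewrite divr_ge0// ltW.
have := powR_le_tangent1 ha yx0.
rewrite -(ler_pM2r (powR_gt0 a x0)) -powRM ?(ltW x0)// divfK ?gt_eqF//.
move=> h; apply: le_trans h _.
rewrite powRB ?(gt_eqF x0) ?implybT// powRr1 ?(ltW x0)//.
by rewrite le_eqVlt; apply/orP; left; apply/eqP; field; rewrite gt_eqF.
Qed.

Lemma powR_slope_nonincreasing (a x x' : R) : 0 < a < 1 -> 0 < x -> x <= x' ->
  a * x' `^ (a - 1) <= a * x `^ (a - 1).
Proof.
move=> /andP[a0 a1] x0 xx'; rewrite ler_pM2l// -[a - 1]opprB !powRN.
have x'0 := lt_le_trans x0 xx'.
rewrite lef_pV2 ?posrE ?powR_gt0//.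
by rewrite ge0_ler_powR ?nnegrE ?subr_ge0 ?(ltW a1) ?(ltW x0) ?(ltW x'0).
Qed.

Definition negxlnx (x : R) : R := - (if x == 0 then 0 else x * ln x).

Lemma negxlnx0 : negxlnx 0 = 0.
Proof. by rewrite /negxlnx eqxx oppr0. Qed.

Lemma negxlnx1 : negxlnx 1 = 0.
Proof. by rewrite /negxlnx oner_eq0 ln1 mulr0 oppr0. Qed.

Lemma shannonE n (x : 'I_n -> R) : shannon x = \sum_i negxlnx (x i).
Proof. by rewrite /shannon -sumrN. Qed.

Lemma negxlnx_le_tangent (x y : R) : 0 < x -> 0 <= y ->
  negxlnx y <= negxlnx x + (- ln x - 1) * (y - x).
Proof.
move=> x0 y0; rewrite /negxlnx (gt_eqF x0); case: eqVneq => [->|yn0].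
  by lra.
have y_gt0 : 0 < y by rewrite lt0r yn0.
(* [ln (1 + u) <= u] at [u = x / y - 1], then multiplied by [y]. *)
have := @le_ln1Dx R (x / y - 1); rewrite ltrDr divr_gt0// addrC subrK.
move=> /(_ isT); rewrite ln_div ?posrE// -(ler_pM2l y_gt0) => h.
have : y * (x / y - 1) = x - y by field; rewrite gt_eqF.
by move=> e; rewrite e in h; lra.
Qed.

(** Each entry lies in [[0, 1]], where [x^alpha >= x]. *)
Lemma sum_powR_ge1 n (x : 'I_n -> R) (alpha : R) : 0 < alpha < 1 ->
  (forall i, 0 <= x i) -> \sum_i x i = 1 -> 1 <= \sum_i x i `^ alpha.
Proof.
move=> /andP[a0 a1] x0 x1; rewrite -x1; apply: ler_sum => i _.
have [->|xi] := eqVneq (x i) 0; first exact: powR_ge0.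
rewrite -[leLHS]powRr1 ?x0// ger_powR ?(ltW a1)// lt0r xi x0/= -x1.
by rewrite (bigD1 i)//= lerDl sumr_ge0.
Qed.

Lemma ln_le_lnD (P Q W : R) : 1 <= P -> 1 <= Q -> 1 + W <= P + Q ->
  ln W <= ln P + ln Q.
Proof.
move=> P1 Q1 PQ.
(* For [W <= 0] the convention [ln W = 0] applies. *)
have [W0|W0] := leP W 0; first by rewrite ln0// addr_ge0// ln_ge0.
have [P0 Q0] : 0 < P /\ 0 < Q by split; apply: lt_le_trans ltr01 _.
rewrite -lnM ?posrE// ler_ln ?posrE ?mulr_gt0//.
have : 0 <= (P - 1) * (Q - 1) by rewrite mulr_ge0 ?subr_ge0.
by move=> h; lra.
Qed.

End EntropyFunctions.

(** * Majorization of [(p, q)] by [(1, W)] and the entropy bounds *)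

Section UncertaintyRelation.
Context {R : realType}.
Local Notation C := (R[i]).
Variables (d : nat) (A B rho : 'M[C]_d).
Hypotheses (d_gt0 : (0 < d)%N).
Hypotheses (oA : orthonormal_cols A) (oB : orthonormal_cols B).
Hypothesis drho : density rho.
Let U := adjmx A *m B.
Let p (i : 'I_d) := expect rho (col i A).
Let q (j : 'I_d) := expect rho (col j B).

(** The convention [s_0 = 0] makes every entry of [W] a difference. *)
Let sigma k := if k == 0%N then 0 else s_coef U k.

(* The vector [(1, W)] padded with zeros; its partial sums telescope. *)
Let oneW k :=
  if k is i.+1 then sigma (minn i.+1 d) - sigma (minn i d) else 1.

Let oneW_lt (i : 'I_d) : oneW i.+1 = Wvec U i.
Proof.
by rewrite /oneW (minn_idPl (ltn_ord i)) (minn_idPl (ltnW (ltn_ord i))).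
Qed.

Let oneW_ge i : (d <= i)%N -> oneW i.+1 = 0.
Proof.
by move=> di; rewrite /oneW !(minn_idPr _) ?subrr// (leq_trans di).
Qed.

Let oneW_ge0 i : 0 <= oneW i.
Proof.
case: i => [|i]; first exact: ler01.
case: (ltnP i d) => [id|/oneW_ge->//].
rewrite (oneW_lt (Ordinal id)); apply: Wvec_ge0.
exact: overlap_isometry.
Qed.

Let sum_oneW k : \sum_(i < k.+1) oneW i = 1 + sigma (minn k d).
Proof.
elim: k => [|k IH]; first by rewrite big_ord1 min0n /sigma eqxx addr0.
by rewrite big_ord_recr/= IH -addrA subrKC.
Qed.

Let sigma_d : sigma d = 1.
Proof.
by rewrite /sigma gt_eqF// s_coef_last//; apply: overlap_isometry.
Qed.

Let sigma_ge0 k : 0 <= sigma (minn k d).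
Proof.
rewrite /sigma; case: eqP => // /eqP; rewrite -lt0n => h.
by apply: s_coef_ge0; [exact: overlap_isometry|rewrite h geq_minr].
Qed.

Let pq (e : 'I_d + 'I_d) := match e with inl i => p i | inr j => q j end.

Let sum_p_le1 (I : {set 'I_d}) : \sum_(i in I) p i <= 1.
Proof.
rewrite -(sum_expect drho oA) [leRHS](bigID (mem I))/= lerDl.
by apply: sumr_ge0 => i _; apply: expect_ge0.
Qed.

Let sum_q_le1 (J : {set 'I_d}) : \sum_(j in J) q j <= 1.
Proof.
rewrite -(sum_expect drho oB) [leRHS](bigID (mem J))/= lerDl.
by apply: sumr_ge0 => i _; apply: expect_ge0.
Qed.

(** If [S] meets only one basis, its weight is at most 1; otherwise the submatrix on [I] and [J]
    controls it. *)
Let pq_majorized (S : {set ('I_d + 'I_d)%type}) :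
  \sum_(e in S) pq e <= \sum_(i < #|S|) oneW i.
Proof.
pose I := [set i | inl i \in S]; pose J := [set j | inr j \in S].
have -> : \sum_(e in S) pq e = \sum_(i in I) p i + \sum_(j in J) q j.
  by rewrite big_sumType/=; congr (_ + _); apply: eq_bigl => i; rewrite inE.
have -> : #|S| = (#|I| + #|J|)%N.
  rewrite -!sum1_card big_sumType/=.
  by congr (_ + _)%N; apply: eq_bigl => i; rewrite inE.
have [->|I0] := eqVneq I finset.set0.
  rewrite big_set0 cards0 add0r add0n.
  have [->|] := eqVneq J finset.set0; first by rewrite big_set0 cards0 big_ord0.
  rewrite -card_gt0; case: #|J| => // k _; rewrite sum_oneW.
  by rewrite (le_trans (sum_q_le1 J))// lerDl sigma_ge0.
have [->|J0] := eqVneq J finset.set0.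
  rewrite big_set0 cards0 addr0 addn0.
  move: I0; rewrite -card_gt0; case: #|I| => // k _; rewrite sum_oneW.
  by rewrite (le_trans (sum_p_le1 I))// lerDl sigma_ge0.
rewrite -card_gt0 in I0; rewrite -card_gt0 in J0.
(* Size [k.+2] corresponds to index [k.+1] of [s_coef]; beyond [d] the trivial bound [1 + 1]
   suffices. *)
have [k IJ] : exists k, (#|I| + #|J|)%N = k.+2.
  by exists (#|I|.-1 + #|J|.-1)%N; rewrite -addnS -addSn !prednK.
rewrite IJ sum_oneW; case: (leqP k.+1 d) => kd; last first.
  by rewrite sigma_d lerD.
apply: le_trans (expect_weight_le oA oB drho I J) _.
by rewrite lerD2l /sigma/=; apply: opnorm_le_s_coef => //; apply: overlap_isometry.
Qed.

Lemma sum_concave_le (f c : R -> R) : f 0 = 0 ->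
  (forall x y, 0 < x -> 0 <= y -> f y <= f x + c x * (y - x)) ->
  (forall x x', 0 < x -> x <= x' -> c x' <= c x) ->
  f 1 + \sum_i f (Wvec U i) <= \sum_i f (p i) + \sum_j f (q j).
Proof.
move=> f0 tangent mono.
(* The [2d] entries of [(p, q)] face [(1, W)] followed by [d - 1] zeros; the successor form suits
   [sum_oneW]. *)
have dd : #|{: 'I_d + 'I_d}| = (d + d.-1).+1.
  by rewrite card_sum card_ord -addnS prednK.
have := karamata f0 tangent mono (g := pq) (y := oneW) _ oneW_ge0 pq_majorized.
rewrite big_sumType/= (sum_expect drho oA) (sum_expect drho oB) dd sum_oneW.
rewrite (minn_idPr (leq_addr _ _)) sigma_d big_sumType/=.
move=> h; apply: le_trans (h _ erefl) => {h}; last first.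
  by case=> i; apply: expect_ge0.
rewrite big_ord_recl; under [in leRHS]eq_bigr do rewrite lift0.
rewrite big_split_ord [X in _ <= _ + (_ + X)]big1 ?addr0.
  under [in leLHS]eq_bigr do rewrite -oneW_lt.
  exact: lexx.
by move=> i _; rewrite oneW_ge ?f0// leq_addr.
Qed.

Lemma shannon_uncertainty : shannon (Wvec U) <= shannon p + shannon q.
Proof.
(* For [f x = - x ln x] the leading entry 1 contributes [f 1 = 0]. *)
rewrite !shannonE -[leLHS]add0r -[X in X + _ <= _]negxlnx1.
apply: (@sum_concave_le negxlnx (fun x => - ln x - 1)).
- exact: negxlnx0.
- exact: negxlnx_le_tangent.
by move=> x x' x0 xx'; rewrite lerD2r lerN2 ler_ln ?posrE// (lt_le_trans x0).
Qed.

Lemma renyi_uncertainty (alpha : R) : 0 < alpha < 1 ->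
  renyi alpha (Wvec U) <= renyi alpha p + renyi alpha q.
Proof.
move=> ha; have /andP[a0 a1] := ha; rewrite /renyi lt_eqF// -mulrDr.
rewrite ler_wpM2l ?invr_ge0 ?subr_ge0 ?(ltW a1)//; apply: ln_le_lnD.
- by apply: sum_powR_ge1 => //; [move=> i; exact: expect_ge0|exact: sum_expect].
- by apply: sum_powR_ge1 => //; [move=> i; exact: expect_ge0|exact: sum_expect].
(* The summand 1 is read as [f 1], the contribution of the leading entry of [(1, W)]. *)
have <- : 1 `^ alpha = 1 :> R by rewrite powR1.
apply: (@sum_concave_le (fun x => x `^ alpha) (fun x => alpha * x `^ (alpha - 1))).
- exact: powR0 (lt0r_neq0 a0).
- by move=> x y; exact: powR_le_tangent.
- by move=> x x'; exact: powR_slope_nonincreasing.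
Qed.

End UncertaintyRelation.

Theorem theorem2 (R : realType) (d : nat) (A B rho : 'M[R[i]]_d) (alpha : R) :
  (0 < d)%N ->
  orthonormal_cols A -> orthonormal_cols B -> density rho ->
  0 < alpha <= 1 ->
  renyi alpha (fun i : 'I_d => expect rho (col i A))
    + renyi alpha (fun j : 'I_d => expect rho (col j B))
  >= renyi alpha (Wvec (adjmx A *m B)).
Proof.
move=> d0 oA oB drho /andP[a0]; rewrite le_eqVlt => /predU1P[->|a1].
  by rewrite /renyi eqxx; apply: shannon_uncertainty.
by apply: renyi_uncertainty => //; rewrite a0 a1.
Qed.
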